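(* For all integers $n$ and $0\leq t\leq k$, $$\alpha^t(\mathcal{G}_{n,k})\;=\;\left(\frac{t+1}{k+1}\right)n.$$
   Context: All graphs are finite, undirected, and simple. A graph is chordal if every cycle on at least four vertices has a chord (an edge not in the cycle whose endpoints are both in the cycle). The treewidth of a graph $G$ is the minimum integer $k$ such that $G$ is a subgraph of a chordal graph with no clique on more than $k+1$ vertices. $\mathcal{G}_{n,k}$ denotes the family of $n$-vertex graphs with treewidth $k$; every graph in $\mathcal{G}_{n,k}$ has at least $k+1$ vertices. For a graph $G$ and an integer $t\geq 0$, $\alpha^t(G)$ denotes the maximum cardinality of a set $S\subseteq V(G)$ such that the induced subgraph $G[S]$ has treewidth at most $t$. For a family $\mathcal{G}$ of graphs, $\alpha^t(\mathcal{G})$ is the minimum of $\alpha^t(G)$ over all $G\in\mathcal{G}$.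
   Formalization: As the equality fails for n=3, k=1, t=0 (3/2 is no integer), it is stated for n divisible by k+1; for all n ≥ k+1 the lower bound (t+1)n/(k+1) and the upper bound (t+1)⌈n/(k+1)⌉ are given; n ≤ k, where the family is empty, is excluded. *)

(* Defs.v *)
From HB Require Import structures.
From mathcomp Require Import all_boot all_order all_algebra.
From mathcomp Require Import boolp.

Set Implicit Arguments.
Unset Strict Implicit.
Unset Printing Implicit Defensive.

Record sgraph := SGraph {
  vertex :> finType;
  adj : rel vertex;
  adj_sym : symmetric adj;
  adj_irr : irreflexive adj }.

Definition clique (G : sgraph) (K : {set G}) : Prop :=
  {in K &, forall x y : G, x != y -> adj x y}.

(* A cycle is a repetition-free cyclic sequence of vertices, each adjacent to
   the next one; a chord joins two of its vertices which are not consecutive. *)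
Definition chordal (G : sgraph) : Prop :=
  forall c : seq G, ucycle (@adj G) c -> 4 <= size c ->
    exists x y : G,
      [/\ x \in c, y \in c, adj x y, next c x != y & next c y != x].

(* [subgraph G H] is up to renaming of vertices; H may have more vertices. *)
Definition subgraph (G H : sgraph) : Prop :=
  exists2 f : G -> H, injective f & forall x y : G, adj x y -> adj (f x) (f y).

Definition induced_adj (G : sgraph) (S : {set G}) : rel {x : G | x \in S} :=
  fun x y => adj (val x) (val y).

Lemma induced_adj_sym (G : sgraph) (S : {set G}) : symmetric (@induced_adj G S).
Proof. by move=> x y; apply: adj_sym. Qed.

Lemma induced_adj_irr (G : sgraph) (S : {set G}) :
  irreflexive (@induced_adj G S).
Proof. by move=> x; apply: adj_irr. Qed.

Definition induced (G : sgraph) (S : {set G}) : sgraph :=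
  SGraph (@induced_adj_sym G S) (@induced_adj_irr G S).

Definition chordal_cover (G : sgraph) (w : nat) : Prop :=
  exists H : sgraph,
    [/\ chordal H, subgraph G H & forall K : {set H}, clique K -> #|K| <= w].

Lemma chordal_cover_ex (G : sgraph) : exists w, `[< chordal_cover G w >].
Proof.
have sym : symmetric (fun x y : G => x != y) by move=> x y; rewrite eq_sym.
have irr : irreflexive (fun x y : G => x != y) by move=> x; rewrite eqxx.
exists #|G|; apply/asboolP; exists (SGraph sym irr); split.
- move=> c /andP[_ uc]; case: c uc => [|a [|b [|d [|e c]]]] //= uc _.
  exists a, d; move: uc; rewrite !inE !negb_or.
  case/and3P=> /and4P[ab ad ae _] /and3P[bd _ _] /and3P[/andP[de _] _ _].
  rewrite /= !eqxx !orbT; split=> //.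
  by rewrite (eq_sym d a) (negPf ad) (eq_sym d b) (negPf bd) eq_sym.
- exists id => // x y; apply: contraTneq => ->; by rewrite adj_irr.
- by move=> K _; apply: max_card.
Qed.

(* The minimum integer k such that no clique has more than k + 1 vertices is
   one less than the least bound w = k + 1 on the clique sizes.  In particular
   the graph with no vertices has treewidth -1. *)
Definition treewidth (G : sgraph) : int :=
  ((ex_minn (chordal_cover_ex G))%:Z - 1)%R.

Definition alpha (t : nat) (G : sgraph) : nat :=
  \max_(S : {set G} | (treewidth (induced S) <= t%:Z)%R) #|S|.

(* The minimum of [alpha t] over a family; 0 by convention on an empty one. *)
Definition alpha_family (t : nat) (F : sgraph -> Prop) : nat :=
  if pselect (exists m, `[< exists2 G, F G & alpha t G = m >]) is left exF
  then ex_minn exF else 0.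

Definition graphs_tw (n k : nat) (G : sgraph) : Prop :=
  #|G| = n /\ treewidth G = k%:Z%R.

(* Main.v *)
(** Lower bound: a graph of treewidth k lies in a chordal graph H whose cliques
    have at most k + 1 vertices.  By Dirac's theorem H has a perfect elimination
    ordering, so greedy colouring uses k + 1 colours.  The t + 1 largest colour
    classes contain at least (t + 1) n / (k + 1) vertices of G, and the subgraph
    of H which they induce is chordal without cliques of t + 2 vertices.
    Upper bound: cut n vertices into blocks of k + 1 consecutive vertices and
    make each block a clique; an induced subgraph of treewidth at most t has at
    most t + 1 vertices in each block. *)
Require Import Defs.
From mathcomp Require Import all_boot all_order all_algebra.
From mathcomp Require Import boolp zify.

Set Implicit Arguments.
Unset Strict Implicit.
Unset Printing Implicit Defensive.

Import Order.TTheory GRing.Theory Num.Theory.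

(** * Simplicial vertices of chordal graphs *)

Section Chordless.
Variable G : sgraph.
Implicit Types (x y z v : G) (p q : seq G).

(** Together with [uniq (x :: p)] this describes an induced path; by itself it does not exclude
    repetitions. *)
Fixpoint chordless x p : bool :=
  if p is z :: q
  then [&& adj x z, all (fun u => ~~ adj x u) q & chordless z q] else true.

Lemma chordless_path x p : chordless x p -> path (@adj G) x p.
Proof. by elim: p x => //= z q IH x /and3P[-> _ /IH]. Qed.

(** Skipping along a chord shortens the path and keeps its ends, so induction on the length stops at
    an induced path. *)
Lemma ex_chordless x p : path (@adj G) x p -> uniq (x :: p) ->
  exists q, [/\ chordless x q, uniq (x :: q), last x q = last x p
              & {subset q <= p}].
Proof.
have [m] := ubnP (size p); elim: m x p => // m IH x [|z p] /= szp.
  by move=> _ _; exists [::].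
case/andP=> xz pz /andP[xNzp /andP[zNp up]].
have [/hasP[u up' xu]|/hasPn noadj] := boolP (has (adj x) p).
  (* [z] can be skipped: [x] is adjacent to some [u] further on. *)
  case/splitPr: up' pz szp xNzp zNp up => p1 p2.
  rewrite cat_path /= => /andP[_ /andP[_ pu]] szp xN zN up.
  have [|||q [Cq Uq Lq Sq]] := IH x (u :: p2).
  - by move: szp; rewrite size_cat /=; lia.
  - by rewrite /= xu.
  - rewrite cons_uniq; move: up; rewrite cat_uniq => /and3P[_ _ ->].
    by rewrite andbT; apply: contra xN => xp2; rewrite inE mem_cat xp2 !orbT.
  exists q; split=> //; first by rewrite Lq last_cat.
  by move=> w /Sq wq; rewrite inE mem_cat wq !orbT.
have [|q [Cq Uq Lq Sq]] := IH z p szp pz; first by rewrite /= zNp.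
exists (z :: q); split.
- rewrite /= xz Cq andbT /=; apply/allP => u /Sq; exact: noadj.
- rewrite Uq andbT; apply: contra xNzp; rewrite !inE.
  by case/orP=> [->//|/Sq->]; rewrite orbT.
- by [].
- by move=> u; rewrite !inE => /orP[->//|/Sq->]; rewrite orbT.
Qed.

(** [next] on a cycle unfolds to [next_at]; the default [y0] will be the vertex that closes the path
    to a cycle. *)
Lemma chordless_next_at y0 x p a b : chordless x p -> uniq (x :: p) ->
  a \in x :: p -> b \in x :: p -> adj a b ->
  next_at a y0 x p = b \/ next_at b y0 x p = a.
Proof.
elim: p x => [|z p IH] x.
  by rewrite !inE => _ _ /eqP-> /eqP->; rewrite adj_irr.
rewrite [chordless _ _]/= cons_uniq => /and3P[xz /allP noadj Cz] /andP[_ Uz].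
rewrite inE [b \in _]inE /=.
case: (eqVneq a x) => [->|ax] /= ain; case: (eqVneq b x) => [->|bx] /= bin ab.
- by rewrite adj_irr in ab.
- move: bin; rewrite inE => /orP[/eqP->|/noadj]; [by left | by rewrite ab].
- move: ain; rewrite inE => /orP[/eqP->|/noadj]; first by right.
  by rewrite adj_sym ab.
- exact: IH.
Qed.

Lemma next_at_last y0 x p : uniq (x :: p) -> next_at (last x p) y0 x p = y0.
Proof.
elim: p x => [|z p IH] x; first by rewrite /= eqxx.
rewrite cons_uniq => /andP[xN Uz]; rewrite [last _ _]/= [LHS]/= IH //.
by case: eqP => // E; rewrite -E mem_last in xN.
Qed.

(** If [p] had two vertices, closing the path through [v] would give a cycle of length at least
    four. It would have no chord, since [v] sees only the two ends and the path is induced. *)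
Lemma chordal_chordless_path v x p : chordal G -> chordless x p ->
  uniq (v :: x :: p) -> adj v x -> adj v (last x p) ->
  {in p, forall u, adj v u -> u = last x p} -> size p <= 1.
Proof.
move=> chG Cp Uvp vx vy vonly; rewrite leqNgt; apply/negP => szp.
have Uxp : uniq (x :: p) by case/andP: Uvp.
have vNxp : v \notin x :: p by case/andP: Uvp.
have [||a [b []]] := chG (v :: x :: p); last 1 first.
- have vadj u : u \in x :: p -> adj v u ->
      next (v :: x :: p) v = u \/ next (v :: x :: p) u = v.
    rewrite inE => /orP[/eqP-> _|up vu]; first by left; rewrite /= eqxx.
    right; rewrite (vonly _ up vu) /= ifN ?next_at_last //.
    by apply: contraNneq vNxp => <-; rewrite mem_last.
  rewrite inE [b \in _]inE.
  have [->|anv] := eqVneq a v; have [->|bnv] := eqVneq b v => ain bin ab.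
  + by rewrite adj_irr in ab.
  + by case: (vadj b bin ab) => ->; rewrite eqxx.
  + by rewrite adj_sym in ab; case: (vadj a ain ab) => ->; rewrite eqxx.
  + rewrite /= (negPf anv) (negPf bnv).
    by case: (chordless_next_at v Cp Uxp ain bin ab) => ->; rewrite eqxx.
- rewrite /ucycle /= rcons_path (chordless_path Cp) vx /=.
  by rewrite adj_sym vy; case/andP: Uvp => /= -> ->.
- by rewrite /=; lia.
Qed.

Definition simplicial (S : {set G}) v : Prop :=
  clique [set u in S | adj v u].

(* Two vertices of [B] are joined by a path through the component [C], which
   together with [v] closes to a cycle. *)
Lemma boundary_clique (S R C B : {set G}) v c0 : chordal G ->
  R = [set u in S | (u != v) && ~~ adj v u] -> c0 \in R ->
  C = [set a | connect [rel a b | [&& a \in R, b \in R & adj a b]] c0 a] ->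
  B = [set b in S :\: C | [exists a in C, adj a b]] ->
  [/\ C \subset R, B \subset [set u | adj v u] & clique B].
Proof.
move=> chG defR c0R defC defB; set e := (X in connect X) in defC.
have CR : C \subset R.
  apply/subsetP => a; rewrite defC inE => /connectP[p pp ->].
  elim: p c0 c0R pp {defC} => //= z p IH c cR /andP[/and3P[_ zR _] pz].
  exact: IH zR pz.
have Cclosed a b : a \in C -> b \in R -> adj a b -> b \in C.
  move=> aC bR ab; have aR := subsetP CR a aC; move: aC; rewrite defC !inE.
  by move/connect_trans; apply; apply: connect1; rewrite /e /= aR bR.
have Bv : B \subset [set u | adj v u].
  apply/subsetP => b; rewrite defB !inE.
  case/andP=> /andP[bNC bS] /existsP[a /andP[aC ab]].
  apply: contraNT bNC => bv; apply: (Cclosed a) => //.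
  rewrite defR inE bS bv andbT; apply: contraTneq ab => ->.
  by move/(subsetP CR): aC; rewrite defR inE adj_sym => /and3P[].
split=> // x y xB yB xy; apply/negPn/negP => xyN.
have [vx vy] : adj v x /\ adj v y.
  by move/(subsetP Bv): xB; move/(subsetP Bv): yB; rewrite !inE.
move: (xB) (yB); rewrite defB !inE.
case/andP=> /andP[xNC _] /existsP[a /andP[aC ax]].
case/andP=> /andP[yNC _] /existsP[b /andP[bC yb]].
have esym : connect_sym e.
  by apply: sym_connect_sym => s s'; rewrite /e /= adj_sym andbCA.
have /connectP[p0 pp0 defb] : connect e a b.
  move: aC bC; rewrite defC !inE => ca cb.
  by apply: connect_trans cb; rewrite esym.
case/shortenP: pp0 defb => p pp up _ defb.
have pC : {subset a :: p <= C}.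
  move=> u up'; have : connect e a u by exact: path_connect pp _ up'.
  by move: aC; rewrite defC !inE => ca; apply: connect_trans ca.
have adjp : path (@adj G) x (a :: rcons p y).
  rewrite /= adj_sym ax rcons_path -defb yb andbT /=.
  by apply: sub_path pp => s s' /= /and3P[].
have CNv u : u \in C -> (u != v) && ~~ adj v u.
  by move/(subsetP CR); rewrite defR inE => /andP[].
have uxp : uniq (x :: a :: rcons p y).
  rewrite -rcons_cons cons_uniq rcons_uniq mem_rcons inE negb_or xy up andbT /=.
  apply/andP; split; first by apply: contra xNC => /pC.
  by apply: contra yNC => /pC.
(* The shortened path still runs from [x] to [y] with its interior in [C], where [v] has no
   neighbour. Hence it is a single edge, against [xyN]. *)
have [q [Cq Uq Lq Sq]] := ex_chordless adjp uxp.
rewrite /= last_rcons in Lq.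
have qE u : u \in q -> u = y \/ u \in C.
  move/Sq; rewrite -rcons_cons mem_rcons inE => /orP[/eqP|/pC]; by [left|right].
have sq : size q <= 1.
  apply: (chordal_chordless_path (v := v) chG Cq); rewrite ?Lq //; last first.
    by move=> u /qE[//|/CNv/andP[_ /negP]].
  rewrite cons_uniq Uq andbT inE negb_or.
  have vN w : adj v w -> v != w by apply: contraTneq => <-; rewrite adj_irr.
  rewrite vN //=; apply/negP => /qE[vE|/CNv/andP[/eqP//]].
  by move: vy; rewrite -vE adj_irr.
case: q Cq Lq sq {Uq Sq qE} => [|z [|//]] /=.
  by move=> _ xyE; rewrite xyE eqxx in xy.
by rewrite andbT => xz zy; rewrite zy in xz; rewrite xz in xyN.
Qed.

(** Dirac's lemma, strengthened to avoid the closed neighbourhood of [v] so that the induction on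
    [#|S|] goes through. It passes to [S' = C :|: B], which omits [v]; a vertex of [C] has all its
    neighbours from [S] in [S'], so if simplicial there it is simplicial in [S]. *)
Lemma simplicial_avoiding (S : {set G}) v u : chordal G ->
  v \in S -> u \in S -> u != v -> ~~ adj v u ->
  exists s, [/\ s \in S, s != v, ~~ adj v s & simplicial S s].
Proof.
move=> chG; have [m] := ubnP #|S|; elim: m S v u => // m IH S v u.
move=> szS vS uS uv vu.
pose R := [set u in S | (u != v) && ~~ adj v u].
pose C := [set a | connect [rel a b | [&& a \in R, b \in R & adj a b]] u a].
pose B := [set b in S :\: C | [exists a in C, adj a b]].
have uR : u \in R by rewrite inE uS uv.
have [CR Bv Bcl] := boundary_clique chG erefl uR (erefl C) (erefl B).
have uC : u \in C by rewrite inE connect0.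
have BS : B \subset S by apply/subsetP => b; rewrite !inE => /andP[/andP[]].
have CS : C \subset S.
  by apply: subset_trans CR _; apply/subsetP => b; rewrite inE => /andP[].
pose S' := C :|: B.
have S'm : #|S'| < m.
  rewrite ltnS in szS; apply: leq_trans szS.
  apply: proper_card; apply/properP; split; first by rewrite subUset CS.
  exists v => //; rewrite inE negb_or; apply/andP; split.
    by apply/negP => /(subsetP CR); rewrite inE eqxx andbF.
  by apply/negP => /(subsetP Bv); rewrite inE adj_irr.
have lift s : s \in C -> simplicial S' s ->
    exists s, [/\ s \in S, s != v, ~~ adj v s & simplicial S s].
  move=> sC simp; move: (subsetP CR s sC); rewrite inE => /and3P[sS sv vs].
  exists s; split=> //.
  have sub : [set w in S | adj s w] \subset [set w in S' | adj s w].
    apply/subsetP => w /setIdP[wS sw]; apply/setIdP; split=> //.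
    apply/setUP; case: (boolP (w \in C)) => wNC; [by left | right].
    apply/setIdP; rewrite in_setD wNC wS; split=> //.
    by apply/existsP; exists s; rewrite sC.
  by move=> a b /(subsetP sub) + /(subsetP sub); apply: simp.
have CuB s : s \in S' -> s \notin B -> s \in C.
  by rewrite in_setU => /orP[//|->].
have S'W w w' : w \in S' -> w' \in S' -> w' != w -> ~~ adj w w' ->
    (forall b, b \in B -> (b == w) || adj w b) ->
    exists s, [/\ s \in S, s != v, ~~ adj v s & simplicial S s].
  move=> wS' w'S' ww' Nadj Bw.
  have [s [sS' sw Nws simp]] := IH S' w w' S'm wS' w'S' ww' Nadj.
  apply: (lift s) => //; apply: CuB => //; apply/negP => /Bw.
  by rewrite (negPf sw) (negPf Nws).
(* The induction hypothesis gives a simplicial vertex of [S'] away from a chosen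
   [w]; choosing [w] in [B] whenever possible keeps it out of the clique [B]. *)
pose far w := [exists w' in S', (w' != w) && ~~ adj w w'].
have [/existsP[w /andP[wB /existsP[w' /and3P[w'S' ww' Nw]]]]|noB] :=
    boolP [exists w in B, far w].
  apply: (S'W w w') => //; first by rewrite in_setU wB orbT.
  move=> b bB; case: eqVneq => //= bw; rewrite Bcl // eq_sym //.
(* Now each vertex of [B] is adjacent to all others of [S'], so any [w] in [C] sees the whole of
   [B]. *)
have univ b a : b \in B -> a \in S' -> a != b -> adj b a.
  move=> bB aS' ab; apply: contraNT noB => Nba; apply/existsP; exists b.
  by rewrite bB; apply/existsP; exists a; rewrite aS' ab.
have [/existsP[w /andP[wC /existsP[w' /and3P[w'S' ww' Nw]]]]|noC] :=
    boolP [exists w in C, far w].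
  have wS' : w \in S' by rewrite in_setU wC.
  apply: (S'W w w') => // b bB.
  by case: eqVneq => //= bw; rewrite adj_sym univ // eq_sym.
(* In the remaining case [S'] is a clique, and [u] itself is simplicial. *)
apply: (lift u) => // a b /setIdP[aS' _] /setIdP[bS' _] ab.
case: (boolP (a \in B)) => aB; first by rewrite univ // eq_sym.
apply: contraNT noC => Nab; apply/existsP; exists a.
by rewrite CuB //; apply/existsP; exists b; rewrite bS' eq_sym ab.
Qed.

Lemma chordal_simplicial (S : {set G}) : chordal G -> S != set0 ->
  exists2 s, s \in S & simplicial S s.
Proof.
move=> chG /set0Pn[v vS].
have [/existsP[a /andP[aS /existsP[b /and3P[bS ba Nab]]]]|noN] :=
    boolP [exists a in S, [exists b in S, (b != a) && ~~ adj a b]].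
  by have [s [sS _ _ simp]] := simplicial_avoiding chG aS bS ba Nab; exists s.
exists v => // a b; rewrite !inE => /andP[aS _] /andP[bS _] ab.
apply: contraNT noN => Nab; apply/existsP; exists a; rewrite aS.
by apply/existsP; exists b; rewrite bS eq_sym ab.
Qed.

(** A simplicial vertex is coloured last: with its neighbours in [S] it forms a clique, so these use
    at most [k] colours and one is free. *)
Lemma chordal_coloring k (S : {set G}) : chordal G ->
  (forall K : {set G}, clique K -> #|K| <= k.+1) ->
  exists col : G -> 'I_k.+1, {in S &, forall x y, adj x y -> col x != col y}.
Proof.
move=> chG clk; have [m] := ubnP #|S|; elim: m S => // m IH S szS.
have [->|S0] := eqVneq S set0; first by exists (fun=> ord0) => x; rewrite inE.
have [s sS simp] := chordal_simplicial chG S0.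
have [|col colP] := IH (S :\ s); first by rewrite (cardsD1 s S) sS in szS.
pose N := [set u in S | adj s u].
have sN : s \notin N by rewrite inE adj_irr andbF.
have Nk : #|N| < k.+1.
  have := clk (s |: N); rewrite cardsU1 sN add1n; apply.
  move=> a b; rewrite !in_setU1.
  case/orP=> [/eqP->|aN] /orP[/eqP->|bN] ab.
  - by rewrite eqxx in ab.
  - by move: bN; rewrite inE => /andP[].
  - by move: aN; rewrite inE adj_sym => /andP[].
  - exact: simp.
have [c cN] : exists c, c \notin col @: N.
  apply/existsP; rewrite -negb_forall; apply/negP => /forallP full.
  have : #|[set: 'I_k.+1]| <= #|col @: N| by apply/subset_leq_card/subsetP.
  by rewrite cardsT card_ord leqNgt (leq_ltn_trans (leq_imset_card _ _) Nk).
exists (fun x => if x == s then c else col x) => x y xS yS xy.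
case: (eqVneq x s) xy => [->|xs]; case: (eqVneq y s) => [->|ys] xy.
- by rewrite adj_irr in xy.
- by apply: contraNneq cN => ->; apply: imset_f; rewrite inE yS.
- by apply: contraNneq cN => <-; apply: imset_f; rewrite inE xS adj_sym.
- by apply: colP; rewrite // !inE ?xs ?ys.
Qed.

End Chordless.

(** * Treewidth *)

Lemma induced_chordal (G : sgraph) (S : {set G}) :
  chordal G -> chordal (induced S).
Proof.
move=> chG c /andP[cc uc] szc.
have [||_ [_ [/mapP[x xc ->] /mapP[y yc ->] xy]]] := chG (map val c).
- rewrite /ucycle map_inj_uniq ?uc ?andbT; last exact: val_inj.
  by case: c cc {uc szc} => //= a c; rewrite -map_rcons path_map.
- by rewrite size_map.
rewrite !(next_map val_inj) // !(inj_eq val_inj) => nx ny.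
by exists x, y.
Qed.

(** An embedding maps cliques to cliques of the same size; this is the tool for bounding treewidth
    from below. *)
Lemma clique_chordal_cover (G : sgraph) (K : {set G}) w :
  clique K -> chordal_cover G w -> #|K| <= w.
Proof.
move=> Kcl [H [_ [f finj fadj] clH]].
rewrite -(card_imset _ finj); apply: clH.
move=> _ _ /imsetP[x xK ->] /imsetP[y yK ->].
by rewrite (inj_eq finj) => xy; apply/fadj/Kcl.
Qed.

Lemma chordal_cover_leq (G : sgraph) w w' :
  w <= w' -> chordal_cover G w -> chordal_cover G w'.
Proof.
move=> ww' [H [chH GH clH]]; exists H; split=> // K /clH Kw.
exact: leq_trans Kw ww'.
Qed.

Lemma treewidth_leP (G : sgraph) t :
  (treewidth G <= t%:Z)%R <-> chordal_cover G t.+1.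
Proof.
rewrite /treewidth; case: ex_minnP => m /asboolP Gm mmin; split.
  by move=> mt; apply: chordal_cover_leq Gm; lia.
by move/asboolP/mmin; lia.
Qed.

Lemma chordal_cover_alpha (t : nat) (G : sgraph) (S : {set G}) :
  chordal_cover (induced S) t.+1 -> #|S| <= alpha t G.
Proof. by move=> /treewidth_leP St; rewrite /alpha; apply: leq_bigmax_cond. Qed.

(** The member [G0] rules out the default value 0, so the minimum is attained. *)
Lemma alpha_familyP t (F : sgraph -> Prop) G0 : F G0 ->
  (exists2 G, F G & alpha t G = alpha_family t F) /\
  (forall G, F G -> alpha_family t F <= alpha t G).
Proof.
move=> FG0; rewrite /alpha_family; case: pselect => [exF|[]]; last first.
  by exists (alpha t G0); apply/asboolP; exists G0.
case: ex_minnP => m /asboolP mF mmin; split=> // G FG.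
by apply: mmin; apply/asboolP; exists G.
Qed.

(** * Lower bound *)

(** Start from all classes and discard the lightest one repeatedly: going from [m.+1] classes to [m]
    loses at most a fraction 1/(m+1) of the current weight. *)
Lemma heavy_subset (k n m : nat) (F : 'I_k.+1 -> nat) :
  \sum_i F i = n -> m <= k.+1 ->
  exists2 T : {set 'I_k.+1}, #|T| = m & m * n <= k.+1 * \sum_(i in T) F i.
Proof.
move=> sumF /subnKC; move: (_ - _) => d; elim: d m => [|d IH] m mk.
  exists [set: 'I_k.+1]; first by rewrite cardsT card_ord -mk addn0.
  have -> : m = k.+1 by lia.
  by rewrite -sumF [X in _ <= _ * X](eq_bigl predT) // => i; rewrite inE.
have [|T cT Tn] := IH m.+1; first by lia.
have [i0 i0T] : exists i, i \in T by apply/set0Pn; rewrite -card_gt0 cT.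
pose i := [arg min_(i < i0 in T) F i].
have [iT imin] : i \in T /\ forall j, j \in T -> F i <= F j.
  by rewrite /i; case: arg_minnP.
exists (T :\ i); first by move: cT; rewrite (cardsD1 i) iT => -[].
have Fi : m.+1 * F i <= \sum_(j in T) F j.
  by rewrite -cT -sum_nat_const; apply: leq_sum.
move: Fi Tn; rewrite (big_setD1 i) //=; set s := bigop _ _ _ => Fi Tn.
by nia.
Qed.

Lemma chordal_cover_alpha_geq (G : sgraph) t k : t <= k ->
  chordal_cover G k.+1 -> t.+1 * #|G| <= k.+1 * alpha t G.
Proof.
move=> tk [H [chH [f finj fadj] clH]].
have [col colP] := chordal_coloring [set: H] chH clH.
pose F i := \sum_(x : G | col (f x) == i) 1.
have sumF : \sum_i F i = #|G|.
  by rewrite -sum1_card [RHS](partition_big (fun x => col (f x)) predT).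
have [|T cT] := heavy_subset (m := t.+1) sumF; first by [].
pose S := [set x : G | col (f x) \in T].
have -> : \sum_(i in T) F i = #|S|.
  rewrite -sum1_card (partition_big (fun x => col (f x)) (mem T)) /=.
    apply: eq_bigr => i iT; apply: eq_bigl => x; rewrite inE.
    by case: eqVneq => [->|]; rewrite ?iT ?andbF.
  by move=> x; rewrite inE.
move/leq_trans; apply; rewrite leq_pmul2l //; apply: chordal_cover_alpha.
(* The cover of [induced S] consists of all vertices of [H] with a colour in [T], including those
   outside the image of [f]. *)
pose S' := [set x : H | col x \in T].
exists (induced S'); split; first exact: induced_chordal.
  have fS (x : induced S) : f (val x) \in S' by move: (valP x); rewrite !inE.
  exists (fun x => Sub (f (val x)) (fS x) : induced S').
    by move=> x y [] /finj /val_inj.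
  by move=> x y xy; apply: fadj.
(* A proper colouring is injective on a clique, and here it takes values in [T]. *)
move=> K Kcl; rewrite -cT.
have cinj : {in K &, injective (fun x : induced S' => col (val x))}.
  move=> x y xK yK /eqP cxy; apply/eqP; apply: contraTT cxy => xy.
  by apply: colP; rewrite ?inE //; apply: (Kcl x y).
rewrite -(card_in_imset cinj); apply/subset_leq_card/subsetP.
by move=> _ /imsetP[x _ ->]; move: (valP x); rewrite inE.
Qed.

(** * Upper bound *)

Section Blocks.
Variables n k : nat.

(** The quotient by [k.+1] numbers the blocks; the last block may be smaller. *)
Definition blocks_adj : rel 'I_n :=
  fun x y => (x != y) && (x %/ k.+1 == y %/ k.+1).

Lemma blocks_sym : symmetric blocks_adj.
Proof. by move=> x y; rewrite /blocks_adj eq_sym (eq_sym (x %/ _)). Qed.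

Lemma blocks_irr : irreflexive blocks_adj.
Proof. by move=> x; rewrite /blocks_adj eqxx. Qed.

Definition blocks : sgraph := SGraph blocks_sym blocks_irr.

Lemma blocks_path (x : blocks) p : path (@adj blocks) x p ->
  {in p, forall y : blocks, x %/ k.+1 = y %/ k.+1}.
Proof.
elim: p x => //= z p IH x /andP[/andP[_ /eqP->] zp] y.
by rewrite inE => /orP[/eqP->|/(IH _ zp)].
Qed.

Lemma blocks_chordal : chordal blocks.
Proof.
move=> c /andP[cc uc]; case: c cc uc => [|a [|b [|d [|e c]]]] // cc uc _.
(* A cycle stays inside one block, so its first and third vertices are adjacent; with at least four
   vertices they are not consecutive. *)
have ad : a %/ k.+1 = d %/ k.+1.
  by apply: (blocks_path cc); rewrite mem_rcons !inE eqxx !orbT.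
exists a, d; move: uc; rewrite /= !inE !negb_or.
case/and3P=> /and4P[ab aNd ae _] /and3P[bd _ _] /and3P[/andP[de _] _ _].
rewrite !eqxx !orbT (eq_sym d a) (negPf aNd) (eq_sym d b) (negPf bd).
by split=> //; rewrite /= /blocks_adj ?aNd ?ad ?eqxx // eq_sym.
Qed.

(** Inside one block the remainder modulo [k.+1] determines the vertex. *)
Lemma card_block_leq (K : {set blocks}) : clique K -> #|K| <= k.+1.
Proof.
move=> Kcl; pose r (x : blocks) : 'I_k.+1 := Ordinal (ltn_pmod x (ltn0Sn k)).
rewrite -[X in _ <= X]card_ord -(card_in_imset (f := r)) ?max_card //.
move=> x y xK yK [rxy]; apply/eqP; apply/negPn/negP => xy.
have /andP[_ /eqP q] := Kcl x y xK yK xy.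
by case/eqP: xy; apply: val_inj; rewrite /= (divn_eq x k.+1) q rxy -divn_eq.
Qed.

Lemma blocks_cover : chordal_cover blocks k.+1.
Proof.
exists blocks; split; [exact: blocks_chordal | by exists id |].
exact: card_block_leq.
Qed.

Lemma blocks_tw : k < n -> treewidth blocks = k%:Z%R.
Proof.
move=> kn; rewrite /treewidth; case: ex_minnP => m /asboolP Gm mmin.
have := mmin _ (asboolT blocks_cover).
suff : k.+1 <= m by lia.
(* Since [k < n], the first block is full and is a clique on [k.+1] vertices. *)
pose g (i : 'I_k.+1) : blocks := widen_ord kn i.
have ginj : injective g by move=> i j /(congr1 val) /= /val_inj.
rewrite -[X in X <= _]card_ord -cardsT -(card_imset _ ginj).
apply: clique_chordal_cover Gm => _ _ /imsetP[i _ ->] /imsetP[j _ ->] ij.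
by rewrite /= /blocks_adj ij /= !divn_small ?eqxx.
Qed.

(** Here [m] bounds the number of blocks, and the part of [S] in each block is a clique of
    [induced S]. *)
Lemma blocks_alpha t m : n <= m * k.+1 -> alpha t blocks <= t.+1 * m.
Proof.
move=> nm; apply/bigmax_leqP => S /treewidth_leP Scov.
have bm (x : blocks) : x %/ k.+1 < m by rewrite ltn_divLR // (leq_trans _ nm).
pose blk x := Ordinal (bm x).
rewrite -sum1_card (partition_big blk predT) //= mulnC -[X in X * _]card_ord.
rewrite -sum_nat_const; apply: leq_sum => j _.
pose K := [set x : induced S | blk (val x) == j].
have -> : \sum_(x in S | blk x == j) 1 = #|K|.
  rewrite -(card_imset _ val_inj) -sum1_card; apply: eq_bigl => x.
  apply/andP/imsetP => [[xS xj]|[y yK ->]].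
    by exists (Sub x xS : induced S); rewrite ?inE SubK.
  by move: yK; rewrite inE; split=> //; apply: valP.
apply: clique_chordal_cover Scov => x y.
rewrite !inE => /eqP xj /eqP yj xy; apply/andP; split=> //.
by have /(congr1 val) /= -> : blk (val x) = blk (val y) by rewrite xj yj.
Qed.

End Blocks.

(** The quotient in the formula need not be an integer, so equality is stated when [k.+1] divides
    [n]. In general the value lies between the quotient and the bound given by the number of blocks,
    rounded up. *)
Theorem theorem2 (n t k : nat) (htk : t <= k) (hkn : k < n) :
  [/\ (exists G : sgraph, graphs_tw n k G),
      (k.+1 %| n ->
        (alpha_family t (graphs_tw n k))%:R%R
          = (t.+1%:R / k.+1%:R * n%:R)%R :> rat),
      (t.+1%:R / k.+1%:R * n%:R <= (alpha_family t (graphs_tw n k))%:R :> rat)%R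
    & ((alpha_family t (graphs_tw n k))%:R
        <= t.+1%:R * (Num.ceil (n%:R / k.+1%:R : rat))%:~R :> rat)%R].
Proof.
have Gblocks : graphs_tw n k (blocks n k).
  by split; [rewrite /= card_ord | exact: blocks_tw].
have [[G [Gn Gk] Galpha] amin] := alpha_familyP t Gblocks.
set a := alpha_family _ _ in Galpha amin *.
have lower : t.+1 * n <= k.+1 * a.
  rewrite -Galpha -Gn; apply: chordal_cover_alpha_geq => //.
  by apply/treewidth_leP; rewrite Gk.
have upper m : n <= m * k.+1 -> a <= t.+1 * m.
  by move=> nm; apply: leq_trans (amin _ Gblocks) (blocks_alpha t nm).
have k0 : (0 < k.+1%:R :> rat)%R by rewrite ltr0n.
split.
- by exists (blocks n k).
- case/dvdnP=> m nE; have am : a = t.+1 * m.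
    apply/eqP; rewrite eqn_leq upper ?nE //=.
    by move: lower; rewrite nE mulnA [X in _ <= X]mulnC leq_pmul2r.
  by rewrite am nE !natrM mulrA mulrAC divfK // gt_eqF.
- by rewrite mulrAC ler_pdivrMr // -!natrM ler_nat [a * _]mulnC.
- set z := Num.ceil _.
  have nz : (n%:R / k.+1%:R <= z%:~R :> rat)%R by exact: ceil_ge.
  have z0 : (0 <= z)%R.
    by rewrite -(ler_int rat); apply: le_trans nz; rewrite divr_ge0 // ler0n.
  (* The ceiling is a nonnegative integer, so its absolute value can serve as the natural number [m]
     in [upper]. *)
  rewrite -(gez0_abs z0) in nz *.
  rewrite -natrM ler_nat; apply: upper.
  by rewrite -(ler_nat rat) natrM -ler_pdivrMr.
Qed.
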